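(* Let $(\mathfrak{g},J)$ be a quasi-Kähler Chern-flat Lie algebra whose center $\mathfrak{z}$ has complex dimension one. Then the complex dimension $n$ of $\mathfrak{g}$ is odd. Moreover, there exists a $(1,0)$-frame $\{Z_1,\dots,Z_n\}$ on $\mathfrak{g}$ such that $$[Z_i,Z_j]=Z_{\bar n}\qquad\text{for } i,j=1,\dots,n-1,\ i<j,$$ where $Z_{\bar n}$ is a generator of $\mathfrak{z}^{0,1}$.
   Context: An almost complex Lie algebra $(\mathfrak{g},J)$ is a finite-dimensional real Lie algebra $\mathfrak{g}$ with an endomorphism $J$ satisfying $J^2=-\mathrm{I}$; its complex dimension is $\frac12\dim_{\mathbb{R}}\mathfrak{g}$. Let $\mathfrak{g}\otimes\mathbb{C}=\mathfrak{g}^{1,0}\oplus\mathfrak{g}^{0,1}$ be the splitting into the $\pm i$-eigenspaces of $J$. $(\mathfrak{g},J)$ is quasi-Kähler Chern-flat if $[\mathfrak{g}^{1,0},\mathfrak{g}^{0,1}]=0$ and $[\mathfrak{g}^{1,0},\mathfrak{g}^{1,0}]\subseteq\mathfrak{g}^{0,1}$. For such a Lie algebra the center $\mathfrak{z}$ is $J$-invariant, so it has a complex dimension $\frac12\dim_{\mathbb{R}}\mathfrak{z}$ and a splitting $\mathfrak{z}\otimes\mathbb{C}=\mathfrak{z}^{1,0}\oplus\mathfrak{z}^{0,1}$. A $(1,0)$-frame is a complex basis of $\mathfrak{g}^{1,0}$, and $Z_{\bar j}:=\overline{Z_j}$. Brackets are extended complex-bilinearly to $\mathfrak{g}\otimes\mathbb{C}$.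 *)

(* Defs.v *)
From HB Require Import structures.
From mathcomp Require Import all_boot all_order all_algebra.
From mathcomp Require Import sesquilinear complex.
From mathcomp Require Import ring.

Set Implicit Arguments.
Unset Strict Implicit.
Unset Printing Implicit Defensive.

Import Order.TTheory GRing.Theory Num.Theory.
Local Open Scope ring_scope.

HB.mixin Record Vector_isLieAlgebra (F : fieldType) V of Vector F V := {
  lie : V -> V -> V;
  lie_bilinear : bilinear_for *:%R *:%R lie;
  liexx : forall x, lie x x = 0;
  lie_jacobi : forall x y z,
    lie x (lie y z) + lie y (lie z x) + lie z (lie x y) = 0
}.

#[short(type="lieAlgType")]
HB.structure Definition LieAlgebra (F : fieldType) :=
  {V of Vector_isLieAlgebra F V & Vector F V}.

Section LieTheory.
Variables (F : fieldType) (g : lieAlgType F).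
Implicit Types x y z : g.

HB.instance Definition _ :=
  bilinear_isBilinear.Build F g g g *:%R *:%R (@lie F g) (@lie_bilinear F g).
HB.instance Definition _ x :=
  GRing.isLinear.Build F g g *:%R (lie x) ((@lie_bilinear F g).2 x).

Lemma lieC x y : lie x y = - lie y x.
Proof.
apply/eqP; rewrite -addr_eq0; apply/eqP.
by have := liexx (x + y); rewrite linearDl !linearDr /= !liexx add0r addr0.
Qed.

Lemma lieDl x y z : lie (x + y) z = lie x z + lie y z.
Proof. exact: linearDl. Qed.
Lemma lieDr x y z : lie x (y + z) = lie x y + lie x z.
Proof. exact: linearD. Qed.
Lemma lieNl x y : lie (- x) y = - lie x y.
Proof. exact: linearNl. Qed.
Lemma lieNr x y : lie x (- y) = - lie x y.
Proof. exact: linearN. Qed.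
Lemma lieZl a x y : lie (a *: x) y = a *: lie x y.
Proof. exact: linearZl_LR. Qed.
Lemma lieZr a x y : lie x (a *: y) = a *: lie x y.
Proof. exact: linearZ. Qed.
Definition lieE := (lieDl, lieDr, lieNl, lieNr, lieZl, lieZr).

Definition ad x : 'End(g) := linfun (lie x).

Fact ad_is_linear : linear ad.
Proof.
move=> a x y; apply/lfunP => z.
by rewrite add_lfunE scale_lfunE !lfunE /= linearPl.
Qed.
HB.instance Definition _ := GRing.isLinear.Build F g 'End(g) *:%R ad ad_is_linear.

Definition center : {vspace g} := lker (linfun ad).

Lemma centerP x : reflect (forall y, lie x y = 0) (x \in center).
Proof.
rewrite memv_ker lfunE /=; apply: (iffP eqP) => [adx0 y | x0].
  by have /lfunP/(_ y) := adx0; rewrite !lfunE.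
by apply/lfunP => y; rewrite !lfunE /= x0.
Qed.

End LieTheory.

Arguments center {F} g.

(* V (x) C, with the pair (x, y) standing for x + i y. *)
Definition complexification (R : rcfType) (V : vectType R) : Type := (V * V)%type.

Section Complexification.
Import VectorInternalTheory.
Variables (R : rcfType) (V : vectType R).
Local Notation C := R[i].
Local Notation VC := (complexification V).
Implicit Types (c : C) (X Y : VC).

HB.instance Definition _ := GRing.Zmodule.copy VC (V * V)%type.

Definition cscale c X : VC :=
  (complex.Re c *: X.1 - complex.Im c *: X.2,
   complex.Re c *: X.2 + complex.Im c *: X.1).

Fact cscaleA a b X : cscale a (cscale b X) = cscale (a * b) X.
Proof.
case: a b X => [a a'] [b b'] [x y]; congr pair => /=;
rewrite !(scalerBr, scalerDr) !(scalerBl, scalerDl) !scalerA ?opprD !addrA;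
by rewrite [LHS]addrAC; congr (_ + _); rewrite [LHS]addrAC.
Qed.

Fact cscale1 : left_id (1 : C) cscale.
Proof. by case=> x y; congr pair; rewrite /= !scale1r scale0r ?subr0 ?addr0. Qed.

Fact cscaleDr : right_distributive cscale +%R.
Proof.
move=> [a b] [x y] [x' y']; congr pair; rewrite /= !scalerDr ?opprD;
exact: addrACA.
Qed.

Fact cscaleDl X : {morph cscale^~ X : a b / a + b}.
Proof.
move=> [a b] [a' b']; congr pair; rewrite /= !scalerDl ?opprD; exact: addrACA.
Qed.

HB.instance Definition _ :=
  GRing.Zmodule_isLmodule.Build C VC cscaleA cscale1 cscaleDr cscaleDl.

Lemma complexification_scaleE c X :
  c *: X = (complex.Re c *: X.1 - complex.Im c *: X.2,
            complex.Re c *: X.2 + complex.Im c *: X.1).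
Proof. by []. Qed.

Fact complexification_vect_iso : Vector.axiom (dim V) VC.
Proof.
pose f X : 'rV[C]_(dim V) := \row_j (v2r X.1 0 j +i* v2r X.2 0 j)%C.
pose h (w : 'rV[C]_(dim V)) : VC := 
  (r2v (map_mx (@complex.Re R) w), r2v (map_mx (@complex.Im R) w)).
exists f.
  move=> c X Y; apply/rowP => j; rewrite !mxE /= !(linearD, linearB, linearZ) /=.
  case: c => a b; rewrite linearN !mxE /= mulrN.
  by congr (complex.Complex (_ + _) (_ + _)); rewrite ?[b * _]mulrC.
exists h.
  by move=> [x y]; congr pair; rewrite -[RHS]v2rK; congr r2v;
    apply/rowP => j; rewrite !mxE.
by move=> w; apply/rowP => j; rewrite !mxE /= !r2vK !mxE; case: (w 0 j).
Qed.
HB.instance Definition _ :=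
  Lmodule_hasFinDim.Build C VC complexification_vect_iso.

Definition of_real (x : V) : VC := (x, 0).

Definition cconj X : VC := (X.1, - X.2).

Definition complexify_fun (f : 'End(V)) X : VC := (f X.1, f X.2).

Fact complexify_fun_is_linear f : linear (complexify_fun f).
Proof. move=> c X Y; rewrite [RHS]surjective_pairing /complexify_fun /=.
by rewrite !(linearD, linearB, linearN, linearZ). Qed.
HB.instance Definition _ f :=
  GRing.isLinear.Build C VC VC *:%R (complexify_fun f) (complexify_fun_is_linear f).

Definition complexify_end (f : 'End(V)) : 'End(VC) := linfun (complexify_fun f).

Lemma complexify_endE f X : complexify_end f X = (f X.1, f X.2).
Proof. by rewrite lfunE. Qed.

Definition complexify_vspace (U : {vspace V}) : {vspace VC} :=
  <<map of_real (vbasis U)>>%VS.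

Lemma mem_complexify_vspace U X :
  (X \in complexify_vspace U) = (X.1 \in U) && (X.2 \in U).
Proof.
have of_realM x : x \in U -> of_real x \in complexify_vspace U.
  move=> /coord_vbasis ->.
  rewrite (_ : of_real _ = \sum_i (coord (vbasis U) i x)%:C%C *:
                                  of_real (vbasis U)`_i).
    apply: memv_suml => i _; apply/memvZ/memv_span/map_f.
    by rewrite mem_nth // size_tuple.
  elim/big_ind2: _ => // [x1 X1 x2 X2 <- <-|i _].
    by congr pair; rewrite /= ?addr0.
  by congr pair; rewrite /= ?scale0r ?scaler0 ?subr0 ?addr0.
apply/idP/andP => [/coord_span -> | [X1 X2]].
  suff memS (n : nat) (r : seq VC) (k : 'I_n -> C) :
      {subset r <= [pred Y : VC | (Y.1 \in U) && (Y.2 \in U)]} ->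
      (\sum_(i < n) k i *: r`_i).1 \in U /\ (\sum_(i < n) k i *: r`_i).2 \in U.
    apply: memS => _ /mapP[x xU ->]; rewrite inE.
    by apply/andP; split; [apply: vbasis_mem xU | apply: mem0v].
  move=> rU; elim/big_ind: _ => [|Y Z [? ?] [? ?]|i _]; first by split; apply: mem0v.
    by split; apply: memvD.
  have [ir|ri] := ltnP i (size r); last first.
    by rewrite nth_default // scaler0; split; apply: mem0v.
  have /andP[? ?] := rU _ (mem_nth 0 ir).
  by split; rewrite (memvB, memvD) ?memvZ.
have -> : X = of_real X.1 + (0 +i* 1)%C *: of_real X.2.
  by case: (X) => x y; congr pair;
    rewrite /= ?scale0r ?scaler0 ?scale1r ?subr0 ?addr0 ?add0r.
by rewrite memvD ?memvZ ?of_realM.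
Qed.

End Complexification.

Section ComplexifiedLie.
Import VectorInternalTheory.
Variables (R : rcfType) (g : lieAlgType R).
Local Notation gC := (complexification g).
Implicit Types X Y Z : gC.

(* The C-bilinear extension of the bracket of g. *)
Definition complexify_lie X Y : gC :=
  (lie X.1 Y.1 - lie X.2 Y.2, lie X.1 Y.2 + lie X.2 Y.1).

Fact complexify_liexx X : complexify_lie X X = 0.
Proof. by congr pair; rewrite /= ?liexx ?subr0 // lieC addNr. Qed.

Fact coordP (u v : g) : (forall j, v2r u 0 j = v2r v 0 j) -> u = v.
Proof. by move=> uv; apply: (can_inj v2rK); apply/rowP. Qed.

Fact complexify_lie_bilinear :
  bilinear_for *:%R *:%R (complexify_lie : gC -> gC -> gC).
Proof.
split=> [[z z'] [a b] [x x'] [y y']|[z z'] [a b] [x x'] [y y']].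
  by rewrite /complexify_lie complexification_scaleE /=; congr pair;
    rewrite /= !lieE; apply: coordP => j;
    rewrite !(linearD, linearN, linearZ) !mxE /=; ring.
by rewrite /complexify_lie complexification_scaleE /=; congr pair;
  rewrite /= !lieE; apply: coordP => j;
  rewrite !(linearD, linearN, linearZ) !mxE /=; ring.
Qed.

Fact complexify_lie_jacobi X Y Z :
  complexify_lie X (complexify_lie Y Z) + complexify_lie Y (complexify_lie Z X)
    + complexify_lie Z (complexify_lie X Y) = 0.
Proof.
pose jac (x y z : g) := lie x (lie y z) + lie y (lie z x) + lie z (lie x y).
have jac0 x y z : jac x y z = 0 := lie_jacobi x y z.
case: X Y Z => [x x'] [y y'] [z z']; congr pair; rewrite /= !lieE.
  transitivity (jac x y z - jac x y' z' - jac x' y z' - jac x' y' z).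
    by apply: coordP => j; rewrite /jac !(linearD, linearN) !mxE; ring.
  by rewrite !jac0 !subr0.
transitivity (jac x y z' + jac x y' z + jac x' y z - jac x' y' z').
  by apply: coordP => j; rewrite /jac !(linearD, linearN) !mxE; ring.
by rewrite !jac0 !addr0 subr0.
Qed.

HB.instance Definition _ := Vector_isLieAlgebra.Build R[i] gC
  complexify_lie_bilinear complexify_liexx complexify_lie_jacobi.

Lemma complexification_lieE X Y :
  lie X Y = (lie X.1 Y.1 - lie X.2 Y.2, lie X.1 Y.2 + lie X.2 Y.1).
Proof. by []. Qed.

End ComplexifiedLie.


Section QuasiKahlerChernFlat.
Variables (R : rcfType).

(* dim_R U / 2; the halving is exact on J-invariant subspaces, see
   cdim_double, and center_stable for the center. *)
Definition cdim (V : vectType R) (U : {vspace V}) : nat := (\dim U)./2.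

Definition almost_complex (V : vectType R) (J : 'End(V)) : Prop :=
  (J \o J)%VF = - \1%VF.

Lemma cdim_double (V : vectType R) (J : 'End(V)) (U : {vspace V}) :
  almost_complex J -> (J @: U <= U)%VS -> \dim U = (cdim U).*2.
Proof.
move=> J2 /subvP JU; rewrite /cdim -[LHS]odd_double_half.
suff /negbTE-> : ~~ odd (\dim U) by [].
pose b := vbasis U.
have bU i : b`_i \in U.
  have [ib|bi] := ltnP i (size b); first exact/vbasis_mem/mem_nth.
  by rewrite nth_default // mem0v.
pose A : 'M[R]_(\dim U) := \matrix_(i, j) coord b j (J b`_i).
have JbE i : J b`_i = \sum_j coord b j (J b`_i) *: b`_j.
  by apply/coord_vbasis/JU/memv_img.
have AA : A *m A = (- 1)%:M.
  apply/matrixP => i k; rewrite !mxE.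
  have Jb2 : J (J b`_i) = - b`_i.
    by have /lfunP/(_ b`_i) := J2; rewrite !lfunE /= lfunE.
  transitivity (coord b k (J (J b`_i))).
    rewrite [in RHS]JbE linear_sum linear_sum; apply: eq_bigr => j _.
    by rewrite !mxE !linearZ.
  rewrite Jb2 linearN /= coord_free ?(basis_free (vbasisP U)) //.
  by rewrite mulNrn.
have := congr1 determinant AA; rewrite det_mulmx det_scalar => detA.
apply/negP => oddU; have := sqr_ge0 (\det A).
by rewrite expr2 detA -signr_odd oddU expr1 oppr_ge0 ler10.
Qed.

Variable g : lieAlgType R.
Implicit Types J : 'End(g).

Definition g10 J : {vspace complexification g} :=
  passmx.leigenspace (complexify_end J) 'i%C.

Definition g01 J : {vspace complexification g} :=
  passmx.leigenspace (complexify_end J) (- 'i%C).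

Lemma mem_g10 J X : (X \in g10 J) = (complexify_end J X == 'i%C *: X).
Proof.
by rewrite memv_ker add_lfunE opp_lfunE scale_lfunE id_lfunE subr_eq0.
Qed.

Lemma mem_g01 J X : (X \in g01 J) = (complexify_end J X == - 'i%C *: X).
Proof.
by rewrite memv_ker add_lfunE opp_lfunE scale_lfunE id_lfunE subr_eq0.
Qed.

Definition qK_Chern_flat J : Prop :=
  [/\ almost_complex J,
      {in g10 J & g01 J, forall X Y, lie X Y = 0}
    & {in g10 J &, forall X Y, lie X Y \in g01 J}].

Lemma center_stable J : qK_Chern_flat J -> (J @: center g <= center g)%VS.
Proof.
move=> [J2 g1001 _]; apply/subvP => _ /memv_imgP[x /centerP x0 ->].
have JJ y : J (J y) = - y by have /lfunP/(_ y) := J2; rewrite !lfunE /= lfunE.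
apply/centerP => y.
have X10 : ((x, - J x) : complexification g) \in g10 J.
  rewrite mem_g10 complexify_endE complexification_scaleE /=.
  rewrite [J (- _)]linearN /= JJ.
  by rewrite !scale0r !scale1r sub0r add0r !opprK.
have Y01 : ((y, J y) : complexification g) \in g01 J.
  rewrite mem_g01 complexify_endE complexification_scaleE /= JJ.
  by rewrite !oppr0 !scale0r !scaleN1r sub0r add0r opprK.
have := congr1 snd (g1001 _ _ X10 Y01).
rewrite complexification_lieE /= x0 add0r lieNl => /eqP.
by rewrite oppr_eq0 => /eqP.
Qed.

Definition z01 J : {vspace complexification g} :=
  (complexify_vspace (center g) :&: g01 J)%VS.

End QuasiKahlerChernFlat.

(* Main.v *)
Require Import Defs.
From mathcomp Require Import all_boot all_order all_algebra.
From mathcomp Require Import complex reals sesquilinear.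
Import GRing.Theory Num.Theory.
Local Open Scope ring_scope.

(** Write gC for the complexification of g, zC for that of the center, and
    W = g^{1,0}.  The bracket of two elements of W lies in g^{0,1}, hence
    commutes with W, and by the Jacobi identity it commutes with g^{0,1} as
    well: [W, W] is contained in z^{0,1} ([lie_g10_center]).  Conversely an
    element of W that commutes with W also commutes with g^{0,1}, so it is
    central ([center_g10P]).  Thus the bracket restricted to W is an
    alternating form with values in z^{0,1}, and its radical is exactly
    z^{1,0}.

    When the center has complex dimension one, z^{0,1} is a line spanned by
    some zeta, and z^{1,0} is the line spanned by the conjugate of zeta.  An
    alternating form is a nondegenerate one plus its radical, so dim W - 1 is
    even, which is the parity claim.  The frame comes from a normal form of
    alternating forms ([alternating_chain_basis]): modulo the radical there is
    a basis s_1, s_2, ... in which b(s_i, s_j) has the same value for all i < j.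
    Rather than converting a symplectic basis into this one by a change of
    matrices, the induction that splits off hyperbolic planes is arranged so
    that it produces such a basis directly.

    Complex dimensions are defined as halves of real ones; [cdim_parts]
    identifies them with the dimensions of the (1,0) and (0,1) parts, because
    conjugation exchanges these two parts. *)

Set Implicit Arguments.
Unset Strict Implicit.
Unset Printing Implicit Defensive.

(** * Normal form of alternating forms *)

Section AlternatingNormalForm.
Variables (F : fieldType) (V W : vectType F).
Variable b : {bilinear V -> V -> W | *:%R & *:%R}.
Hypothesis bxx : forall x, b x x = 0.

Lemma alternating_antisym x y : b x y = - b y x.
Proof.
apply/eqP; rewrite -addr_eq0; apply/eqP.
by have := bxx (x + y); rewrite linearDl !linearDr /= !bxx add0r addr0.
Qed.

Definition radical (U : {vspace V}) x := x \in U /\ {in U, forall y, b x y = 0}.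

Definition orthov (U : {vspace V}) u v : {vspace V} :=
  (U :&: (lker (linfun (b u)) :&: lker (linfun (b v))))%VS.

Lemma orthovP (U : {vspace V}) u v x :
  reflect [/\ x \in U, b u x = 0 & b v x = 0] (x \in orthov U u v).
Proof.
rewrite !memv_cap !memv_ker !lfunE /=.
by apply: (iffP and3P) => -[-> /eqP-> /eqP->].
Qed.

Section HyperbolicPair.
Variables (zeta : W) (U : {vspace V}) (u v : V).
Hypothesis zeta0 : zeta != 0.
Hypothesis bU : {in U &, forall x y, b x y \in <[zeta]>%VS}.
Hypotheses (uU : u \in U) (vU : v \in U) (buv : b u v = zeta).

(** For b(u, x) = d zeta and b(v, x) = c zeta, the vector x + c u - d v is
    orthogonal to both u and v. *)
Lemma hyperbolic_decomp x : x \in U ->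
  exists c d, exists2 y, y \in orthov U u v & x = c *: u + d *: v + y.
Proof.
move=> xU; have /vlineP[d bux] := bU uU xU; have /vlineP[c bvx] := bU vU xU.
exists (- c), d; exists (x - (- c *: u + d *: v)); last by rewrite addrC subrK.
apply/orthovP; split; first by rewrite memvB // memvD // memvZ.
  by rewrite linearB linearD !linearZ /= bxx buv scaler0 add0r bux subrr.
rewrite linearB linearD !linearZ /= bxx (alternating_antisym v u) buv bvx.
by rewrite scaler0 addr0 scalerN scaleNr opprK subrr.
Qed.

(** A radical vector is orthogonal to u and v, and U is spanned by u, v and
    their orthogonal.  Hence the same family r serves as a basis of the radical
    at every stage of the induction below. *)
Lemma radical_ortho x : radical (orthov U u v) x <-> radical U x.
Proof.
split=> [[/orthovP[xU bux bvx] xrad]|[xU xrad]].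
  split=> // y /hyperbolic_decomp[c [d [z zU' ->]]].
  rewrite !linearD !linearZ /= (xrad _ zU').
  by rewrite (alternating_antisym x u) (alternating_antisym x v) bux bvx;
     rewrite !oppr0 !scaler0 !addr0.
split=> [|y /orthovP[yU _ _]]; last exact: xrad.
by apply/orthovP; split=> //; rewrite alternating_antisym xrad // oppr0.
Qed.

(** The sum <u> + <v> + orthov U u v is direct: pairing an element of it with u
    reads off its coefficient along v, and vice versa. *)
Lemma dim_ortho_ge : (\dim (orthov U u v) + 2 <= \dim U)%N.
Proof.
have u0 : u != 0.
  by apply: contraNneq zeta0 => u0; rewrite -buv u0 linear0l.
have v0 : v != 0.
  by apply: contraNneq zeta0 => v0; rewrite -buv v0 linear0r.
have scale_zeta c : c *: zeta = 0 -> c = 0.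
  by move=> /eqP; rewrite scaler_eq0 (negbTE zeta0) orbF => /eqP.
have vU' : (<[v]> :&: orthov U u v = 0)%VS.
  apply/eqP; rewrite -subv0; apply/subvP => x /memv_capP[/vlineP[d ->]].
  case/orthovP => _ + _.
  by rewrite linearZ /= buv => /scale_zeta->; rewrite scale0r mem0v.
have uvU' : (<[u]> :&: (<[v]> + orthov U u v) = 0)%VS.
  apply/eqP; rewrite -subv0; apply/subvP => x /memv_capP[/vlineP[c ->]].
  case/memv_addP => _ /vlineP[d ->] [y /orthovP[_ _ bvy]] /(congr1 (b v)).
  rewrite linearD !linearZ /= bxx bvy scaler0 addr0 alternating_antisym buv.
  rewrite scalerN => /eqP; rewrite oppr_eq0 => /eqP/scale_zeta->.
  by rewrite scale0r mem0v.
have -> : (\dim (orthov U u v) + 2)%N = \dim (<[u]> + (<[v]> + orthov U u v)).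
  by rewrite !dimv_disjoint_sum // !dim_vline u0 v0 addnC.
by apply: dimvS; rewrite !subv_add -!memvE uU vU; apply: capvSl.
Qed.

End HyperbolicPair.

(** Induction on the dimension.  If b is nonzero on U, choose u, v with
    b(u, v) = zeta and let s be the family obtained in the orthogonal of
    {u, v}.  The vector t = v - u satisfies b(u, t) = b(v, t) = zeta, so
    replacing every x in s by t + x makes its product with u and with v equal
    to zeta, while b(t + x, t + y) = b(x, y) because t is orthogonal to s.
    Thus u, v, t + s has the required products, in any characteristic. *)
Lemma alternating_chain_basis (zeta : W) (U : {vspace V}) (r : seq V) :
    {in U &, forall x y, b x y \in <[zeta]>%VS} ->
    (forall x, x \in <<r>>%VS <-> radical U x) -> free r ->
  exists s, [/\ ~~ odd (size s), pairwise (fun x y => b x y == zeta) s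
              & basis_of U (s ++ r)].
Proof.
have [m] := ubnP (\dim U); elim: m U => // m IHm U leUm bU radr freer.
have [radU | nradU] := boolP (U <= <<r>>)%VS.
  exists [::]; split=> //; rewrite basisEfree freer.
  rewrite cat0s (leq_trans (dimvS radU) (dim_span r)) andbT.
  by apply/subvP => x /radr[].
have [u uU [v vU buv0]] : exists2 u, u \in U & exists2 v, v \in U & b u v != 0.
  case/subvPn: nradU => u uU /negP nru; exists u => //.
  pose B := vbasis U.
  have [/hasP[v /vbasis_mem vU bv]|/hasPn b0] :=
    boolP (has (fun v => b u v != 0) B); first by exists v.
  case: nru; apply/radr; split=> // y /coord_vbasis->.
  rewrite linear_sum big1 // => i _; rewrite linearZ /=.
  have /b0 : B`_i \in B by rewrite mem_nth // size_tuple.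
  by rewrite negbK => /eqP->; rewrite scaler0.
have /vlineP[k bk] := bU u v uU vU.
have [k0 zeta0] : k != 0 /\ zeta != 0.
  by apply/andP; move: buv0; rewrite bk scaler_eq0 negb_or.
wlog buv : v vU {buv0 k bk k0} / b u v = zeta.
  move/(_ (k^-1 *: v)); apply; first exact: memvZ.
  by rewrite linearZ /= bk scalerA mulVf // scale1r.
have leU'm := dim_ortho_ge zeta0 uU vU buv.
have [|||s [evs chs bs]] := IHm (orthov U u v) _ _ _ freer.
- move: leUm; rewrite ltnS; apply: leq_trans.
  by rewrite addn2 in leU'm; apply: ltnW.
- by move=> x y /orthovP[xU _ _] /orthovP[yU _ _]; apply: bU.
- move=> x; split=> [/radr/(radical_ortho bU uU vU buv)//|].
  by move/(radical_ortho bU uU vU buv)/radr.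
(* An equation rather than a local definition, so that rewriting by linearity
   does not split t. *)
have [t tE] : exists t, t = v - u by exists (v - u).
have but : b u t = zeta by rewrite tE linearB /= bxx buv subr0.
have bvt : b v t = zeta.
  by rewrite tE linearB /= bxx sub0r alternating_antisym buv opprK.
have sU' x : x \in s -> [/\ x \in U, b u x = 0 & b v x = 0].
  move=> xs; apply/orthovP; rewrite -(span_basis bs) memv_span //.
  by rewrite mem_cat xs.
have btx x : x \in s -> b t x = 0.
  by case/sU' => _ bux bvx; rewrite tE linearBl /= bux bvx subrr.
exists [:: u, v & map (+%R t) s]; split.
- by rewrite /= size_map negbK.
- rewrite /= buv eqxx /= !all_map pairwise_map; apply/and3P; split.
  + apply/allP => x /sU'[_ bux _]; apply/eqP => /=.
    by rewrite linearDr /= but bux addr0.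
  + apply/allP => x /sU'[_ _ bvx]; apply/eqP => /=.
    by rewrite linearDr /= bvt bvx addr0.
  rewrite (eq_in_pairwise (P := [in s]) (r' := fun x y => b x y == zeta)) //.
    move=> x y xs ys /=.
    rewrite linearDl !linearDr /= bxx add0r (btx y) // add0r.
    by rewrite (alternating_antisym x) (btx x) // oppr0 add0r.
rewrite basisEdim; apply/andP; split; last first.
  have := size_basis (X := in_tuple _) bs; rewrite size_cat => dU'.
  by rewrite dU' addn2 in leU'm; rewrite /= size_cat size_map.
set S := span _.
have [uS vS] : u \in S /\ v \in S.
  by split; apply: memv_span; rewrite !inE eqxx ?orbT.
apply/subvP => x /(hyperbolic_decomp bU uU vU buv)[c [d [y yU' ->]]].
rewrite !memvD ?memvZ //.
have /subvP : (orthov U u v <= S)%VS; last exact.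
rewrite -(span_basis bs); apply/span_subvP => z; rewrite mem_cat => /orP[zs|zr].
  have -> : z = (t + z) - (v - u) by rewrite -tE addrC addKr.
  rewrite !memvB //; apply: memv_span.
  by rewrite !inE mem_cat (map_f (+%R t)) ?orbT.
by apply: memv_span; rewrite !inE mem_cat zr !orbT.
Qed.

End AlternatingNormalForm.

(** * Conjugation and types *)

Section Conjugation.
Variables (R : rcfType) (V : vectType R).
Local Notation VC := (complexification V).
Implicit Types (X Y : VC) (A B : {vspace VC}) (U : {vspace V}).

Lemma cconjK : involutive (@cconj R V).
Proof. by case=> x y; rewrite /cconj /= opprK. Qed.

Lemma cconj0 : cconj (0 : VC) = 0.
Proof. by rewrite /cconj /= oppr0. Qed.

Lemma cconjD X Y : cconj (X + Y) = cconj X + cconj Y.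
Proof. by congr pair; rewrite /= opprD. Qed.

Lemma cconjZ (c : R[i]) X : cconj (c *: X) = c^*%C *: cconj X.
Proof.
case: c X => [a a'] [x y]; congr pair; rewrite /= !scaleNr scalerN ?opprK //.
by rewrite opprD.
Qed.

Lemma cconj_sum (I : Type) (s : seq I) (f : I -> VC) :
  cconj (\sum_(i <- s) f i) = \sum_(i <- s) cconj (f i).
Proof. exact: (big_morph _ cconjD cconj0). Qed.

(** Conjugation is only semilinear, so its effect on dimensions is obtained by
    conjugating the coefficients of a vanishing combination. *)
Lemma dimv_cconj_le A B :
  {in A, forall X, cconj X \in B} -> (\dim A <= \dim B)%N.
Proof.
move=> AB; have freeB : free (map_tuple (@cconj R V) (vbasis A)).
  apply/freeP => k /(congr1 (@cconj R V)); rewrite cconj_sum cconj0 => k0 i.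
  apply/eqP; rewrite -conjc_eq0; apply/eqP; move: i.
  apply: (elimT freeP (basis_free (vbasisP A)) (fun i => (k i)^*%C)).
  rewrite -[RHS]k0; apply: eq_bigr => i _.
  by rewrite cconjZ (nth_map 0) ?size_tuple // cconjK.
have /eqP := freeB; rewrite /= size_map size_tuple => <-; apply: dimvS.
by apply/span_subvP => _ /mapP[X /vbasis_mem XA ->]; apply: AB.
Qed.

Lemma dimv_cconj A B : {in A, forall X, cconj X \in B} ->
  {in B, forall X, cconj X \in A} -> \dim A = \dim B.
Proof. by move=> AB BA; apply/eqP; rewrite eqn_leq !dimv_cconj_le. Qed.

Lemma dimv_complexify U : \dim (complexify_vspace U) = \dim U.
Proof.
have freeU : free (map_tuple (@of_real R V) (vbasis U)).
  apply/freeP => k k0.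
  have sum_pair : \sum_i k i *: (map_tuple (@of_real R V) (vbasis U))`_i =
      (\sum_i complex.Re (k i) *: (vbasis U)`_i,
       \sum_i complex.Im (k i) *: (vbasis U)`_i) :> VC.
    elim/big_rec3: _ => [//|i x y X _ ->].
    rewrite (nth_map 0) ?size_tuple // complexification_scaleE /=.
    by congr pair; rewrite /= scaler0 ?subr0 ?add0r.
  move: k0; rewrite sum_pair => -[re0 im0] i.
  have /(_ _ re0 i) re_i := elimT freeP (basis_free (vbasisP U)) _.
  have /(_ _ im0 i) im_i := elimT freeP (basis_free (vbasisP U)) _.
  by case: (k i) re_i im_i => x y /= -> ->.
by have /eqP := freeU; rewrite /= size_map size_tuple.
Qed.

End Conjugation.

Section TypeDecomposition.
Variables (R : rcfType) (g : lieAlgType R) (J : 'End(g)).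
Local Notation gC := (complexification g).
Implicit Types (X Y : gC) (U : {vspace g}).

Lemma conjc_imaginary : ('i^*)%C = - 'i%C :> R[i].
Proof. by apply/eqP; rewrite eq_complex /= oppr0 !eqxx. Qed.

Lemma conjcN_imaginary : ((- 'i)^*)%C = 'i%C :> R[i].
Proof. by rewrite -conjc_imaginary conjcK. Qed.

Lemma cconj_g01 X : (cconj X \in g01 J) = (X \in g10 J).
Proof.
rewrite mem_g01 mem_g10 !complexify_endE; apply/eqP/eqP.
  move/(congr1 (@cconj R g)); rewrite cconjZ cconjK conjcN_imaginary => <-.
  by rewrite /cconj /= [J (- _)]linearN opprK.
move/(congr1 (@cconj R g)); rewrite cconjZ conjc_imaginary => <-.
by rewrite /cconj /= [J (- _)]linearN.
Qed.

Lemma cconj_g10 X : (cconj X \in g10 J) = (X \in g01 J).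
Proof. by rewrite -cconj_g01 cconjK. Qed.

Lemma cconj_complexify U X :
  (cconj X \in complexify_vspace U) = (X \in complexify_vspace U).
Proof. by rewrite !mem_complexify_vspace /= memvN. Qed.

Lemma g10_g01_disjoint : (g10 J :&: g01 J = 0)%VS.
Proof.
apply/eqP; rewrite -subv0; apply/subvP => X /memv_capP[X10 X01].
have iX : complexify_end J X = 'i%C *: X by apply/eqP; rewrite -mem_g10.
have NiX : complexify_end J X = - 'i%C *: X by apply/eqP; rewrite -mem_g01.
have : ('i%C + 'i%C) *: X = 0.
  by rewrite scalerDl -[X in X + _]iX NiX scaleNr addNr.
move/eqP; rewrite scaler_eq0 memv0 => /orP[|//].
by rewrite eq_complex /= -[1 + 1]/(2%:R) pnatr_eq0 andbF.
Qed.

Hypothesis J2 : almost_complex J.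

(** X is the half sum of X - i J X, of type (1,0), and X + i J X, of type (0,1);
    [P] and [Q] below are these two vectors in real coordinates. *)
Lemma g10_g01_split U X : (J @: U <= U)%VS -> X \in complexify_vspace U ->
  exists2 X10, X10 \in (complexify_vspace U :&: g10 J)%VS &
  exists2 X01, X01 \in (complexify_vspace U :&: g01 J)%VS & X = X10 + X01.
Proof.
move=> /subvP JU; rewrite mem_complexify_vspace => /andP[X1 X2].
have JJ y : J (J y) = - y by have /lfunP/(_ y) := J2; rewrite !lfunE /= lfunE.
pose P : gC := (X.1 + J X.2, X.2 - J X.1).
pose Q : gC := (X.1 - J X.2, X.2 + J X.1).
have JXU : J X.1 \in U /\ J X.2 \in U by split; apply/JU/memv_img.
exists (2^-1 *: P); last exists (2^-1 *: Q).
- rewrite memvZ // memv_cap mem_complexify_vspace mem_g10 /= !memvD ?memvN //;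
    try by case: JXU.
  rewrite complexify_endE complexification_scaleE /= !scale0r !scale1r.
  rewrite [J (_ + _)]linearD [J (_ - _)]linearB /= !JJ sub0r add0r opprB.
  by apply/eqP; congr pair; rewrite opprK addrC.
- rewrite memvZ // memv_cap mem_complexify_vspace mem_g01 /= !memvD ?memvN //;
    try by case: JXU.
  rewrite complexify_endE complexification_scaleE /= !oppr0 !scale0r !scaleN1r.
  rewrite [J (_ - _)]linearB [J (_ + _)]linearD /= !JJ sub0r add0r opprB.
  by rewrite !opprK [J X.1 + _]addrC.
rewrite -scalerDr; have -> : P + Q = 2 *: X.
  rewrite scaler_nat mulr2n; congr pair;
    by rewrite /= addrACA ?subrr ?addNr addr0.
by rewrite scalerA mulVf ?scale1r // pnatr_eq0.
Qed.

(** Conjugation exchanges the two parts, so they have equal dimensions, and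
    these add up to the real dimension of U. *)
Lemma cdim_parts U : (J @: U <= U)%VS ->
  \dim (complexify_vspace U :&: g10 J) = cdim U /\
  \dim (complexify_vspace U :&: g01 J) = cdim U.
Proof.
move=> JU; set UC := complexify_vspace U.
have half (a b n : nat) : a = b -> (a + b)%N = n.*2 -> a = n /\ b = n.
  by move=> <-; rewrite addnn => /double_inj->.
apply: half.
  apply: dimv_cconj => X /memv_capP[XU X1];
    rewrite memv_cap cconj_complexify XU.
    by rewrite cconj_g01.
  by rewrite cconj_g10.
rewrite -(cdim_double J2 JU) -dimv_complexify -/UC.
rewrite -dimv_disjoint_sum; last first.
  by apply/eqP; rewrite -subv0 -g10_g01_disjoint capvS ?capvSr.
apply: (congr1 (fun S : {vspace gC} => \dim S)); apply/eqP; rewrite eqEsubv.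
apply/andP; split; first by rewrite subv_add; apply/andP; split; apply: capvSl.
apply/subvP => X /(g10_g01_split JU)[X10 mX10 [X01 mX01 ->]].
exact: memv_add mX10 mX01.
Qed.

Lemma dim_g10 : \dim (g10 J) = cdim {:g}.
Proof.
have [<- _] := cdim_parts (subvf (J @: {:g})).
congr (\dim _); apply/eqP; rewrite eqEsubv capvSr andbT; apply/subvP => X X10.
by rewrite memv_cap X10 mem_complexify_vspace !memvf.
Qed.

Lemma g10_g01_full X :
  exists2 X10, X10 \in g10 J & exists2 X01, X01 \in g01 J & X = X10 + X01.
Proof.
have XU : X \in complexify_vspace {:g} by rewrite mem_complexify_vspace !memvf.
have [Y /memv_capP[_ Y10] [Z /memv_capP[_ Z01] ->]] :=
  g10_g01_split (subvf (J @: {:g})) XU.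
by exists Y; [exact: Y10 | exists Z; first exact: Z01].
Qed.

End TypeDecomposition.

(** * The bracket on the (1,0) part *)

Section ComplexifiedCenter.
Variables (R : rcfType) (g : lieAlgType R).
Local Notation gC := (complexification g).
Local Notation zC := (complexify_vspace (center g)).
Implicit Types X Y : gC.

Lemma complexify_centerP X : reflect (forall Y, lie X Y = 0) (X \in zC).
Proof.
rewrite mem_complexify_vspace; apply: (iffP andP).
  case=> /centerP X1 /centerP X2 Y.
  by rewrite complexification_lieE !X1 !X2 subrr addr0.
move=> X0; split; apply/centerP => y; have := X0 (of_real y);
  by rewrite complexification_lieE /= ![lie _ 0]linear0 subr0 add0r => -[].
Qed.

Variable J : 'End(g).
Hypothesis hJ : qK_Chern_flat J.

(** The radical of the bracket on g^{1,0} is z^{1,0}, since g^{1,0} always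
    commutes with g^{0,1}. *)
Lemma center_g10P X : X \in g10 J ->
  X \in zC <-> {in g10 J, forall Y, lie X Y = 0}.
Proof.
case: hJ => J2 g1001 _ X10; split=> [/complexify_centerP X0 Y _ //|X0].
apply/complexify_centerP => Y.
have [Y10 Y10P [Y01 Y01P ->]] := g10_g01_full J2 Y.
by rewrite lieDr (X0 _ Y10P) (g1001 _ _ X10 Y01P) addr0.
Qed.

(** [X, Y] has type (0,1), so it commutes with g^{1,0}; against W of type (0,1)
    the Jacobi identity reduces [[X, Y], W] to [Y, W] and [W, X], which
    vanish. *)
Lemma lie_g10_center : {in g10 J &, forall X Y, lie X Y \in z01 J}.
Proof.
case: hJ => J2 g1001 g1010 X Y X10 Y10.
have XY01 := g1010 _ _ X10 Y10.
rewrite memv_cap XY01 andbT.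
have g0110 : {in g01 J & g10 J, forall X Y, lie X Y = 0}.
  by move=> A B A01 B10; rewrite lieC (g1001 _ _ B10 A01) oppr0.
apply/complexify_centerP => W.
have [W10 W10P [W01 W01P ->]] := g10_g01_full J2 W.
rewrite lieDr (g0110 _ _ XY01 W10P) add0r.
have := lie_jacobi X Y W01.
rewrite (g1001 _ _ Y10 W01P) (g0110 _ _ W01P X10).
rewrite ![lie _ 0]linear0 !add0r lieC => /eqP.
by rewrite oppr_eq0 => /eqP.
Qed.

End ComplexifiedCenter.

(** * The adapted frame *)

Theorem theorem4p6 (R : realType) (g : lieAlgType R) (J : 'End(g))
    (hJ : qK_Chern_flat J) (hz : cdim (center g) = 1%N) :
  odd (cdim {:g}) /\
  let n := cdim {:g} in
  exists Z : n.-tuple (complexification g),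
    [/\ basis_of (g10 J) Z,
        forall i j : nat, (i < j)%N -> (j < n.-1)%N ->
          lie Z`_i Z`_j = cconj Z`_n.-1
      & z01 J = <[cconj Z`_n.-1]>%VS].
Proof.
have [J2 _ _] := hJ.
have [_ dim_z01] := cdim_parts J2 (center_stable hJ).
pose zeta := vpick (z01 J).
have zeta0 : zeta != 0 by rewrite vpick0 -dimv_eq0 dim_z01 hz.
have z01E : z01 J = <[zeta]>%VS.
  apply/eqP; rewrite eq_sym eqEdim -memvE memv_pick dim_vline zeta0.
  by rewrite dim_z01 hz.
have mem_zeta X : X \in <<[:: cconj zeta]>>%VS = (cconj X \in z01 J).
  rewrite span_seq1 z01E; apply/vlineP/vlineP => -[c Xc]; exists (c^*%C).
    by rewrite Xc cconjZ cconjK.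
  by rewrite -[X]cconjK Xc cconjZ.
have [|||s [evs chs bs]] := @alternating_chain_basis _ _ _
    (@lie _ (complexification g)) (@liexx _ _) zeta (g10 J) [:: cconj zeta].
- by move=> X Y X10 Y10; rewrite -z01E; apply: lie_g10_center.
- move=> X; rewrite mem_zeta memv_cap cconj_complexify cconj_g01.
  split=> [/andP[Xz X10]|[X10 X0]].
    by split=> //; apply/(center_g10P hJ X10).
  by rewrite X10 andbT; apply/(center_g10P hJ X10).
- rewrite seq1_free; apply: contraNneq zeta0 => /(congr1 (@cconj R g)).
  by rewrite cconjK cconj0 => ->.
have szZ : size (s ++ [:: cconj zeta]) == cdim {:g}.
  by rewrite -(dim_g10 J2) (size_basis (X := in_tuple _) bs).
have nE : cdim {:g} = (size s).+1 by rewrite -(eqP szZ) size_cat addn1.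
split; first by rewrite nE.
have lastZ : (s ++ [:: cconj zeta])`_(cdim {:g}).-1 = cconj zeta.
  by rewrite nE nth_cat ltnn subnn.
exists (Tuple szZ); split=> //=; rewrite lastZ cconjK //.
move=> i j ij; rewrite nE /= => js.
have is_ := ltn_trans ij js; rewrite !nth_cat is_ js.
by have /(pairwiseP 0)/(_ i j is_ js ij)/eqP := chs.
Qed.
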